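(* Suppose that $H$ is a near-star with $k$ vertices and $\ell$ leaves, where $\frac{k+1}{2}\leq\ell\leq k-3$. If $T$ is a tree with $k$ vertices containing a path $abc$ such that $a$ is a leaf of $T$ and $b$ and $c$ both have degree two in $T$, then $H\not\succcurlyeq T$.
   Context: All graphs are finite, simple and undirected; $v(\cdot)$, $e(\cdot)$ denote numbers of vertices and edges. $t(H,G)=\hom(H,G)/v(G)^{v(H)}$, where $\hom(H,G)$ is the number of graph homomorphisms from $H$ to $G$. For non-empty graphs (at least one edge) $H,T$, $H\succcurlyeq T$ means $t(H,G)^{e(T)}\geq t(T,G)^{e(H)}$ for every graph $G$. A tree is a near-star if it can be obtained from a star by subdividing edges in such a way that each edge of the star is subdivided at most once. *)

(* Defs.v *)
From mathcomp Require Import all_boot all_order all_algebra.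

Set Implicit Arguments.
Unset Strict Implicit.
Unset Printing Implicit Defensive.

Import Order.TTheory GRing.Theory Num.Theory.

Record sgraph := SGraph {
  vertex :> finType;
  adj : rel vertex;
  adj_sym : symmetric adj;
  adj_irrefl : irreflexive adj
}.

Definition edges (G : sgraph) : {set {set G}} :=
  [set [set p.1; p.2] | p in [set p : G * G | adj p.1 p.2]].

Definition num_edges (G : sgraph) : nat := #|edges G|.

Definition degree (G : sgraph) (x : G) : nat := #|[set y | adj x y]|.

Definition leaves (G : sgraph) : {set G} := [set x | degree x == 1].

Definition is_hom (H G : sgraph) (f : {ffun H -> G}) : bool :=
  [forall x, forall y, adj x y ==> adj (f x) (f y)].

Definition hom (H G : sgraph) : nat := #|[set f : {ffun H -> G} | is_hom f]|.

Definition hom_density (H G : sgraph) : rat :=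
  ((hom H G)%:R / #|G|%:R ^+ #|H|)%R.

(* Only meaningful when H and T both have at least one edge.  The graph G
   without vertices is then harmless: both sides are 0. *)
Definition dominates (H T : sgraph) : Prop :=
  forall G : sgraph,
    (hom_density T G ^+ num_edges H <= hom_density H G ^+ num_edges T)%R.

Definition isomorphic (G G' : sgraph) : Prop :=
  exists2 f : G -> G', bijective f & forall x y, adj (f x) (f y) = adj x y.

Definition connected (G : sgraph) : Prop :=
  0 < #|G| /\ forall x y : G, connect (@adj G) x y.

Definition acyclic (G : sgraph) : Prop :=
  forall c : seq G, 2 < size c -> ~ ucycle (@adj G) c.

Definition is_tree (G : sgraph) : Prop := connected G /\ acyclic G.

(* The star K_{1,m}; None is the centre. *)
Definition star_adj (m : nat) : rel (option 'I_m) :=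
  fun x y => isSome x != isSome y.

Lemma star_adj_sym (m : nat) : symmetric (@star_adj m).
Proof. by move=> x y; rewrite /star_adj eq_sym. Qed.

Lemma star_adj_irrefl (m : nat) : irreflexive (@star_adj m).
Proof. by move=> x; rewrite /star_adj eqxx. Qed.

Definition star (m : nat) : sgraph :=
  SGraph (@star_adj_sym m) (@star_adj_irrefl m).

(* Subdivision of G once along each edge of F (used with F \subset edges G):
   inr e is the new vertex in the middle of the edge e. *)
Definition subdivide_adj (G : sgraph) (F : {set {set G}}) :
    rel (G + {e : {set G} | e \in F}) :=
  fun u v => match u, v with
  | inl x, inl y => adj x y && ([set x; y] \notin F)
  | inl x, inr e => x \in val e
  | inr e, inl x => x \in val e
  | inr _, inr _ => false
  end.

Lemma subdivide_adj_sym (G : sgraph) (F : {set {set G}}) :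
  symmetric (@subdivide_adj G F).
Proof. by case=> x [] y //=; rewrite adj_sym setUC. Qed.

Lemma subdivide_adj_irrefl (G : sgraph) (F : {set {set G}}) :
  irreflexive (@subdivide_adj G F).
Proof. by case=> x //=; rewrite adj_irrefl. Qed.

Definition subdivide (G : sgraph) (F : {set {set G}}) : sgraph :=
  SGraph (@subdivide_adj_sym G F) (@subdivide_adj_irrefl G F).

Definition near_star (H : sgraph) : Prop :=
  is_tree H /\
  exists m (F : {set {set star m}}),
    F \subset edges (star m) /\ isomorphic H (subdivide F).

(* Main.v *)
(** Since H and T have the same numbers of vertices and edges, it suffices to
    find G with hom(T, G) > hom(H, G).  Let H have s legs of length two and
    u >= 2 leaves at its centre, so k = 1 + u + 2s, and write N for a large
    integer.  Keep T - {a, b, c} as a pattern and blow it up, giving classes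
    A, B, C, O for a, b, c and the other vertices of T, biregular with degrees
      A -> B : 1          B -> C : 1          C -> O : N^(L-s)   O -> O : N^L
      B -> A : N^(L+s+1)  C -> B : N^(L-s)    O -> C : N^L
    up to constants depending on k only, where L = (u + s)(s + 1).  The obvious
    homomorphisms from T give at least N^(Lk+1).  As
      hom(H, G) <= \sum_v d(v)^u w(v)^s, w(v) the number of 2-walks from v,
    one checks class by class that hom(H, G) = O(N^(Lk)); the conditions used
    are u >= 2 when the centre goes to A or C and s >= 2 when it goes to B.
    The exponents are a dual solution of the linear program asking for a
    probability distribution on homomorphisms H -> T under which every vertex
    and edge of T has one preimage on average. *)

From mathcomp Require Import all_boot all_order all_algebra.
From mathcomp Require Import zify ring.
Require Import Defs.

Set Implicit Arguments.
Unset Strict Implicit.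
Unset Printing Implicit Defensive.

(** * Edges and connectedness *)

Lemma mem_edges (G : sgraph) (x y : G) : ([set x; y] \in edges G) = adj x y.
Proof.
apply/imsetP/idP => [[[u v]]|xy]; last by exists (x, y); rewrite ?inE.
rewrite inE /= => uv /setP xy_uv.
have := xy_uv u; have := xy_uv v; have := xy_uv x; have := xy_uv y.
rewrite !inE !eqxx ?orbT /=.
case/esym/orP=> /eqP yE /esym/orP[]/eqP xE; rewrite ?xE ?yE //.
- by rewrite !orbb => /eqP uv_eq; move: uv; rewrite uv_eq adj_irrefl.
- by rewrite adj_sym.
- by rewrite !orbb => _ /eqP uv_eq; move: uv; rewrite uv_eq adj_irrefl.
Qed.

Lemma edgesP (G : sgraph) (e : {set G}) :
  reflect (exists x y, adj x y /\ e = [set x; y]) (e \in edges G).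
Proof.
apply: (iffP imsetP) => [[[x y]]|[x [y [xy ->]]]].
  by rewrite inE /= => xy ->; exists x, y.
by exists (x, y); rewrite ?inE.
Qed.

(** A set that no edge leaves is closed under reachability, so by connectedness it contains all
    vertices or none. *)
Lemma connected_crossing (G : sgraph) (S : {set G}) :
  connected G -> S != set0 -> S != setT ->
  exists x y, [/\ x \in S, y \notin S & adj x y].
Proof.
case=> _ conn /set0Pn[x xS]; rewrite -subTset => /subsetPn[y _ yS].
have [/existsP[u /existsP[v /and3P[? ? ?]]]|nocross] :=
  boolP [exists u, exists v, [&& u \in S, v \notin S & adj u v]].
  by exists u, v.
suff: closed (@adj G) (mem S).
  by move/closed_connect/(_ _ _ (conn x y)); rewrite /= xS (negPf yS).
apply: intro_closed.
  by apply: sym_connect_sym; exact: adj_sym.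
move=> u v uv uS; apply: contraNT nocross => vS.
by apply/existsP; exists u; apply/existsP; exists v; rewrite uS vS.
Qed.

(** A vertex set grown along crossing edges gains at least one inner edge with each new vertex. *)
Lemma connected_num_edges (G : sgraph) :
  connected G -> #|G| <= (num_edges G).+1.
Proof.
move=> connG; have [/card_gt0P[r _] _] := connG.
suff grow n : n < #|G| -> exists S : {set G},
    #|S| = n.+1 /\ n <= #|[set e in edges G | e \subset S]|.
  have := grow #|G|.-1; have G0 : 0 < #|G| by case: connG.
  rewrite prednK // => /(_ (leqnn _))[S [_ le_e]].
  rewrite -[#|G|]prednK // ltnS (leq_trans le_e) //.
  by apply: subset_leq_card; apply/subsetP=> e; rewrite inE => /andP[].
elim: n => [_|n IHn ltnG]; first by exists [set r]; rewrite cards1.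
have [S [cardS le_e]] := IHn (ltnW ltnG).
have [||x [y [xS yS xy]]] := @connected_crossing G S connG.
- by rewrite -card_gt0 cardS.
- by apply: contraTneq ltnG => S_T; rewrite -cardS S_T cardsT ltnn.
exists (y |: S); rewrite cardsU1 yS cardS; split => //.
(* The crossing edge was not counted before, because [y] lies outside [S]. *)
apply: leq_trans (_ : #|[set x; y] |: [set e in edges G | e \subset S]| <= _).
  rewrite cardsU1 inE subUset !sub1set (negPf yS) !andbF add1n.
  exact: le_e.
apply: subset_leq_card; apply/subsetP=> e; rewrite !inE => /orP[/eqP->|].
  by rewrite mem_edges xy subUset !sub1set !inE xS eqxx orbT.
by case/andP=> -> /subset_trans->; rewrite ?subsetUr.
Qed.

(** * Invariance under isomorphism *)

Lemma isomorphic_inv (G G' : sgraph) : isomorphic G G' -> isomorphic G' G.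
Proof.
case=> f [g fK gK] fadj; exists g; first by exists f.
by move=> x y; rewrite -fadj !gK.
Qed.

Lemma isomorphic_num_edges (G G' : sgraph) :
  isomorphic G G' -> num_edges G <= num_edges G'.
Proof.
move/isomorphic_inv=> [f [g fK gK] fadj].
apply: leq_trans (leq_imset_card (fun e : {set G'} => f @: e) _).
apply: subset_leq_card; apply/subsetP=> _ /edgesP[x [y [xy ->]]].
apply/imsetP; exists [set g x; g y]; last by rewrite imsetU1 imset_set1 !gK.
by rewrite mem_edges -fadj !gK.
Qed.

Lemma isomorphic_hom (H H' G : sgraph) :
  isomorphic H H' -> hom H G <= hom H' G.
Proof.
move/isomorphic_inv=> [f [g fK gK] fadj].
pose F (h : {ffun H -> G}) := [ffun x => h (f x)].
have F_inj : injective F.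
  move=> h1 h2 /ffunP eqF; apply/ffunP=> x.
  by have := eqF (g x); rewrite !ffunE gK.
rewrite /hom -(card_imset _ F_inj); apply: subset_leq_card.
apply/subsetP=> _ /imsetP[h + ->]; rewrite !inE => /forallP homh.
apply/forallP=> x; apply/forallP=> y; apply/implyP=> xy; rewrite !ffunE.
by apply: (implyP (forallP (homh _) _)); rewrite fadj.
Qed.

Lemma isomorphic_leaves (G G' : sgraph) :
  isomorphic G G' -> #|leaves G| <= #|leaves G'|.
Proof.
case=> f [g fK gK] fadj; have f_inj := can_inj fK.
rewrite -(card_imset _ f_inj); apply: subset_leq_card.
apply/subsetP=> _ /imsetP[x + ->]; rewrite !inE => /eqP<-; apply/eqP.
rewrite /degree -(card_imset _ f_inj); congr #|pred_of_set _|.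
apply/setP=> y; rewrite -(gK y) (mem_imset _ _ f_inj) !inE.
by rewrite fadj.
Qed.

(** * Subdivided stars: order, edges, leaves and homomorphisms *)

Section SubdividedStar.

Variables (m : nat) (F : {set {set star m}}).
Hypothesis F_edges : F \subset edges (star m).

Let spoke (i : 'I_m) : {set star m} := [set None; Some i].
Let center : subdivide F := inl None.
Let tip (i : 'I_m) : subdivide F := inl (Some i).

Let spoke_inj : injective spoke.
Proof. by move=> i j /setP/(_ (Some i)); rewrite !inE eqxx => /esym/eqP[]. Qed.

Let edge_spoke e : e \in F -> exists i, e = spoke i.
Proof.
move/(subsetP F_edges)/edgesP => [[x|] [[y|] [//]]] _ ->.
  by exists x; rewrite setUC.
by exists y.
Qed.

Let card_spoke : #|[set i | spoke i \in F]| = #|F|.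
Proof.
rewrite -(card_imset _ spoke_inj); congr #|pred_of_set _|.
apply/setP=> e; apply/imsetP/idP => [[i]|eF]; first by rewrite inE => ? ->.
by have [i eE] := edge_spoke eF; exists i; rewrite // inE -eE.
Qed.

Lemma card_subdivided_star : #|subdivide F| = (m + #|F|).+1.
Proof. by rewrite card_sum card_option card_ord card_sig. Qed.

Lemma card_star_edges_le : #|F| <= m.
Proof. by rewrite -card_spoke -[m in _ <= m]card_ord max_card. Qed.

Let mid_val (i : 'I_m) (e : {e | e \in F}) :
  (Some i \in val e) = (val e == spoke i).
Proof.
have [j ->] := edge_spoke (valP e).
by rewrite !inE (inj_eq spoke_inj) (inj_eq Some_inj) eq_sym.
Qed.

Let center_val (e : {e | e \in F}) : None \in val e.
Proof. by have [j ->] := edge_spoke (valP e); rewrite !inE. Qed.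

(** The tree is rooted at [center], whose own value is only a default. *)
Let parent (x : subdivide F) : subdivide F :=
  if x is inl (Some i) then
    if insub (spoke i) is Some e then inr e else center
  else center.

Let parent_edge x y : adj x y -> parent x = y \/ parent y = x.
Proof.
have par_inr (e : {e | e \in F}) (z : option 'I_m) : z \in val e ->
    parent (inl z) = inr e \/ parent (inr e) = inl z.
  case: z => [i|] ze; last by right.
  by left; move: ze; rewrite mid_val => /eqP spoke_i; rewrite /= -spoke_i valK.
case: x y => [x|e] [y|e'] //=; last 2 first.
- exact: par_inr.
- by move/par_inr; case; [right|left].
case/andP; case: x y => [i|] [j|] // _ eF; [left|right].
  by rewrite insubN // /spoke setUC.
by rewrite insubN.
Qed.

(** Every edge joins a non-central vertex to its parent, so there are at most as many edges as
    non-central vertices. *)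
Lemma num_edges_subdivided_star : num_edges (subdivide F) <= m + #|F|.
Proof.
have -> : m + #|F| = #|[set~ center]|.
  by rewrite cardsC1 card_subdivided_star.
apply: leq_trans (leq_imset_card (fun x => [set x; parent x]) _).
apply: subset_leq_card; apply/subsetP=> _ /edgesP[x [y [xy ->]]].
have parentP u v : adj u v -> parent u = v ->
  [set u; v] \in [set [set x; parent x] | x in [set~ center]].
  move=> uv puv; apply/imsetP; exists u; last by rewrite puv.
  rewrite !inE; apply: contraTneq uv => u_c; move: puv.
  by rewrite u_c => <-; rewrite adj_irrefl.
have [/parentP-> //|pyx] := parent_edge xy.
by rewrite setUC parentP // adj_sym.
Qed.

(** The neighbour of the centre on leg [i]: the midpoint if the leg is subdivided, otherwise the
    tip. *)
Let first_of (i : 'I_m) : subdivide F :=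
  if insub (spoke i) is Some e then inr e else tip i.

Let adj_first i : adj center (first_of i).
Proof.
by rewrite /first_of; case: insubP => [e _ eE|iF] /=; [exact: center_val|].
Qed.

Let first_inj : injective first_of.
Proof.
move=> i j; rewrite /first_of; case: insubP => [e _ eE|_];
  case: insubP => [e' _ e'E|_] //.
  by case=> ee'; apply: spoke_inj; rewrite -eE -e'E ee'.
by case.
Qed.

Let degree_gt1 (x y z : subdivide F) :
  adj x y -> adj x z -> y != z -> x \notin leaves (subdivide F).
Proof.
move=> xy xz yz; rewrite inE neq_ltn; apply/orP; right.
by apply/card_gt1P; exists y, z; rewrite !inE.
Qed.

(** The leaves are the tips: a tip sees only its parent, a midpoint sees the centre and a tip, and
    the centre sees two legs because [1 < m]. *)
Lemma card_leaves_subdivided_star : 1 < m -> #|leaves (subdivide F)| = m.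
Proof.
move=> m_gt1; have tip_inj : injective tip by move=> i j [].
rewrite -[RHS]card_ord -cardsT -(card_imset _ tip_inj).
congr #|pred_of_set _|; apply/setP=> -[[i|]|e].
- rewrite (mem_imset _ _ tip_inj) inE [RHS]inE -(cards1 (parent (tip i))).
  apply/eqP; congr #|pred_of_set _|; apply/setP=> y; rewrite !inE.
  apply/idP/eqP => [/parent_edge[-> //|]|->].
    by case: y => [[j|]|e] //=; case: insub.
  rewrite /parent /tip; case: insubP => [e _ eE|iF] /=.
    by rewrite mid_val eE.
  by rewrite setUC.
- rewrite (negPf (degree_gt1 (adj_first (Ordinal (ltnW m_gt1)))
                   (adj_first (Ordinal m_gt1)) _)) ?(inj_eq first_inj) //.
  by apply/esym/imsetP => -[].
- have [i eE] := edge_spoke (valP e).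
  rewrite (negPf (@degree_gt1 _ center (tip i) _ _ _)) //=.
  + by apply/esym/imsetP => -[].
  + exact: center_val.
  + by rewrite mid_val; apply/eqP.
Qed.

(** Once the image [v] of the centre is fixed, the legs can be chosen independently: a neighbour of
    [v] for a plain leg, a 2-walk from [v] for a subdivided one. *)
Lemma hom_subdivided_star (G : sgraph) :
  hom (subdivide F) G <=
  \sum_(v : G) degree v ^ (m - #|F|) * (\sum_(w | adj v w) degree w) ^ #|F|.
Proof.
(* A leg without subdivision is encoded by a diagonal pair. *)
pose legs v (i : 'I_m) : {set G * G} :=
  if spoke i \in F then [set p | adj v p.1 && adj p.1 p.2]
  else [set p | adj v p.1 && (p.1 == p.2)].
have card_legs v i : #|legs v i| =
    if spoke i \in F then \sum_(w | adj v w) degree w else degree v.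
  rewrite /legs; case: ifP => _.
    rewrite -sum1dep_card -(pair_big_dep (adj v) (@adj G) (fun _ _ => 1)) /=.
    by apply: eq_bigr => w _; rewrite sum1dep_card.
  rewrite /degree -(card_imset _ (_ : injective (fun w : G => (w, w)))).
    congr #|pred_of_set _|; apply/setP=> -[w w']; rewrite inE /=.
    apply/andP/imsetP => [[vw /eqP<-]|[u + [-> ->]]].
      by exists w; rewrite ?inE.
    by rewrite inE.
  by move=> w w' [].
have prod_legs v : \prod_i #|legs v i| =
    degree v ^ (m - #|F|) * (\sum_(w | adj v w) degree w) ^ #|F|.
  under eq_bigr do rewrite card_legs.
  rewrite mulnC (bigID (fun i => spoke i \in F)) /=; congr (_ * _).
    rewrite (eq_bigr (fun=> \sum_(w | adj v w) degree w)) => [|i -> //].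
    rewrite prod_nat_const -card_spoke; congr (_ ^ _).
    by apply: eq_card => i; rewrite !inE.
  rewrite (eq_bigr (fun=> degree v)) => [|i /negPf-> //].
  rewrite prod_nat_const -card_spoke; congr (_ ^ _).
  have := cardC [set i | spoke i \in F]; rewrite card_ord => cardFC.
  rewrite -[RHS](congr1 (subn^~ _) cardFC) addKn.
  by apply: eq_card => i; rewrite !inE.
under eq_bigr do rewrite -prod_legs.
(* Every vertex is the centre, a tip or the first vertex of a leg, so these images determine [f]. *)
pose enc (f : {ffun subdivide F -> G}) :=
  (f center, [ffun i => (f (first_of i), f (tip i))]).
have enc_inj : injective enc.
  move=> f g [fg_c /ffunP fg]; apply/ffunP=> -[[i|]|e] //.
    by have := fg i; rewrite !ffunE => -[].
  have [i eE] := edge_spoke (valP e); have := fg i.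
  by rewrite !ffunE /first_of -eE valK => -[].
rewrite /hom -(card_imset _ enc_inj).
pose P := [set p : G * {ffun 'I_m -> G * G} | p.2 \in family (legs p.1)].
apply: leq_trans (_ : #|P| <= _).
  apply/subset_leq_card/subsetP=> _ /imsetP[f + ->]; rewrite !inE => homf.
  have {}homf x y : adj x y -> adj (f x) (f y).
    by move=> xy; apply: (implyP (forallP (forallP homf x) y)).
  apply/familyP=> i; rewrite ffunE /legs; case: ifP => iF; rewrite inE /= homf //.
    apply: homf; rewrite /first_of; case: insubP => [e _ eE /=|].
      by rewrite mid_val; apply/eqP.
    by rewrite iF.
  by rewrite /first_of insubN ?iF /=.
rewrite -sum1dep_card.
rewrite -(pair_big_dep predT (fun v g => g \in family (legs v)) (fun _ _ => 1)) /=.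
apply: leq_sum => v _; rewrite sum1dep_card.
rewrite (_ : [set g | g \in family (legs v)] = [set g in family (legs v)]) //.
by rewrite cardsE card_family foldrE big_map big_enum.
Qed.

End SubdividedStar.

(** * The blow-up of [T] and its degree and 2-walk sums *)

Lemma sum_adj_cover (G : sgraph) (v : G) (Z : finType) (h : Z -> G)
    (f : G -> nat) :
  (forall w, adj v w -> exists z, w = h z) ->
  \sum_(w | adj v w) f w <= \sum_z f (h z).
Proof.
(* Grouping the [z] by [h z], each neighbour has a nonempty fibre; repetitions and non-neighbours
   only enlarge the right side. *)
move=> cover; rewrite [leqRHS](partition_big h predT) //=.
rewrite big_mkcond; apply: leq_sum => w _; case: ifP => // /cover[z ->].
by rewrite (bigD1 z) //= leq_addr.
Qed.

Lemma leq_expn2r e m n : m <= n -> m ^ e <= n ^ e.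
Proof. by case: e => // e mn; rewrite leq_exp2r. Qed.

Lemma degreeE (G : sgraph) (v : G) : degree v = \sum_(w | adj v w) 1.
Proof. by rewrite sum1dep_card. Qed.

(* With q = N^s and p = N^(L-s), [blowup_base] has N^L elements.  All vertices
   of T label a copy in the class O, including a, b and c: the extra vertices
   only change constants. *)
Section PendantBlowup.

Variables (T : sgraph) (p q N : nat).

Definition blowup_base : finType := ('I_q * 'I_p)%type.
Definition blowup_O : finType := (T * blowup_base)%type.
Definition blowup_C : finType := ('I_q * blowup_base)%type.
Definition blowup_B : finType := (blowup_C * 'I_p)%type.
Definition blowup_A : finType := (blowup_B * (blowup_base * 'I_q * 'I_N))%type.

Definition blowup_vertex : finType :=
  ((blowup_A + blowup_B) + (blowup_C + blowup_O))%type.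

(** Between consecutive classes the coordinate tests give disjoint complete bipartite graphs, hence
    biregularity. A point of C meets [p] of the [q * p] copies of each label in O. *)
Definition blowup_adj : rel blowup_vertex := fun x y =>
  match x, y with
  | inl (inl a), inl (inr b) | inl (inr b), inl (inl a) => a.1 == b
  | inl (inr b), inr (inl c) | inr (inl c), inl (inr b) => b.1 == c
  | inr (inl c), inr (inr o) | inr (inr o), inr (inl c) => c.1 == o.2.1
  | inr (inr o), inr (inr o') => adj o.1 o'.1
  | _, _ => false
  end.

Lemma blowup_adj_sym : symmetric blowup_adj.
Proof. by move=> [[a|b]|[c|o]] [[a'|b']|[c'|o']] //=; rewrite adj_sym. Qed.

Lemma blowup_adj_irrefl : irreflexive blowup_adj.
Proof. by move=> [[a|b]|[c|o]] //=; rewrite adj_irrefl. Qed.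

Definition blowup : sgraph := SGraph blowup_adj_sym blowup_adj_irrefl.

Definition in_A (a : blowup_A) : blowup := inl (inl a).
Definition in_B (b : blowup_B) : blowup := inl (inr b).
Definition in_C (c : blowup_C) : blowup := inr (inl c).
Definition in_O (o : blowup_O) : blowup := inr (inr o).

Let t := #|T|.
Let d := q * p.
Let Q := d * q * N.

Let card_base : #|blowup_base| = d.
Proof. by rewrite card_prod !card_ord. Qed.

Let card_branch : #|(blowup_base * 'I_q * 'I_N : finType)%type| = Q.
Proof. by rewrite !card_prod !card_ord. Qed.

Let card_C : #|blowup_C| = q * d.
Proof. by rewrite card_prod card_base card_ord. Qed.

Let card_B : #|blowup_B| = d ^ 2.
Proof. by rewrite card_prod card_C card_ord /d; nia. Qed.

Let card_A : #|blowup_A| = d ^ 2 * Q.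
Proof. by rewrite card_prod card_B card_branch. Qed.

Let card_O : #|blowup_O| = t * d.
Proof. by rewrite card_prod card_base. Qed.

(** This bound and its analogues for B, C and O are used twice: with [f] constantly 1 for degrees,
    and with [f] the degree for 2-walks. *)
Lemma sum_adj_A (a : blowup_A) (f : blowup -> nat) :
  \sum_(w | adj (in_A a) w) f w <= f (in_B a.1).
Proof.
have := @sum_adj_cover blowup (in_A a) unit (fun=> in_B a.1) f.
rewrite [leqRHS](big_pred1 tt) => [|[]//]; apply=> -[[a'|b]|[c|o]] //= /eqP ab.
by exists tt; rewrite ab.
Qed.

Lemma sum_adj_B (b : blowup_B) (f : blowup -> nat) :
  \sum_(w | adj (in_B b) w) f w <=
  \sum_(e : blowup_base * 'I_q * 'I_N) f (in_A (b, e)) + f (in_C b.1).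
Proof.
have := @sum_adj_cover blowup (in_B b) ((blowup_base * 'I_q * 'I_N) + unit)%type
  (fun z => match z with inl e => in_A (b, e) | inr _ => in_C b.1 end) f.
rewrite [leqRHS]big_sumType /= [X in _ + X](big_pred1 tt) => [|[]//].
apply=> -[[[b' e]|b']|[c|o]] //= /eqP bE.
  by exists (inl e); rewrite -bE.
by exists (inr tt); rewrite bE.
Qed.

Lemma sum_adj_C (c : blowup_C) (f : blowup -> nat) :
  \sum_(w | adj (in_C c) w) f w <=
  \sum_(j < p) f (in_B (c, j)) +
  \sum_(z : T * 'I_p) f (in_O (z.1, (c.1, z.2))).
Proof.
have := @sum_adj_cover blowup (in_C c) ('I_p + T * 'I_p)%type
  (fun z => match z with
            | inl j => in_B (c, j) | inr z => in_O (z.1, (c.1, z.2)) end) f.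
rewrite [leqRHS]big_sumType /=; apply=> -[[a|[c' j]]|[c'|[x [i j]]]] //= /eqP cE.
  by exists (inl j); rewrite -cE.
by exists (inr (x, j)); rewrite cE.
Qed.

(** Summing over all of O ignores adjacency in [T]; this affects only factors depending on
    [#|T|]. *)
Lemma sum_adj_O (o : blowup_O) (f : blowup -> nat) :
  \sum_(w | adj (in_O o) w) f w <=
  \sum_(e : blowup_base) f (in_C (o.2.1, e)) + \sum_(o' : blowup_O) f (in_O o').
Proof.
have := @sum_adj_cover blowup (in_O o) (blowup_base + blowup_O)%type
  (fun z => match z with inl e => in_C (o.2.1, e) | inr o' => in_O o' end) f.
rewrite [leqRHS]big_sumType /=; apply=> -[[a|b]|[[i e]|o']] //=.
  by move/eqP=> <-; exists (inl e).
by move=> _; exists (inr o').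
Qed.

Lemma degree_A (a : blowup_A) : degree (in_A a) <= 1.
Proof. by rewrite degreeE sum_adj_A. Qed.

Lemma degree_B (b : blowup_B) : degree (in_B b) <= Q + 1.
Proof.
rewrite degreeE; apply: leq_trans (sum_adj_B _ _) _.
by rewrite sum1_card card_branch.
Qed.

Lemma degree_C (c : blowup_C) : degree (in_C c) <= p + t * p.
Proof.
rewrite degreeE; apply: leq_trans (sum_adj_C _ _) _.
by rewrite !sum1_card card_prod !card_ord.
Qed.

Lemma degree_O (o : blowup_O) : degree (in_O o) <= d + t * d.
Proof.
rewrite degreeE; apply: leq_trans (sum_adj_O _ _) _.
by rewrite !sum1_card card_O card_base.
Qed.

Let leq_sum_const (I : finType) n (f : I -> nat) M :
  #|I| = n -> (forall i, f i <= M) -> \sum_i f i <= n * M.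
Proof. by move=> <- fM; rewrite -sum_nat_const; apply: leq_sum => i _. Qed.

Lemma sum_degree_A (a : blowup_A) :
  \sum_(w | adj (in_A a) w) degree w <= Q + 1.
Proof. exact: leq_trans (sum_adj_A _ _) (degree_B _). Qed.

Lemma sum_degree_B (b : blowup_B) :
  \sum_(w | adj (in_B b) w) degree w <= Q + (p + t * p).
Proof.
apply: leq_trans (sum_adj_B _ _) _; apply: leq_add (degree_C _).
by rewrite -[Q]muln1; apply: leq_sum_const => // e; apply: degree_A.
Qed.

Lemma sum_degree_C (c : blowup_C) :
  \sum_(w | adj (in_C c) w) degree w <= p * (Q + 1) + t * p * (d + t * d).
Proof.
apply: leq_trans (sum_adj_C _ _) _; apply: leq_add.
  by apply: leq_sum_const => [|j]; [rewrite card_ord | exact: degree_B].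
by apply: leq_sum_const => [|z]; [rewrite card_prod card_ord | exact: degree_O].
Qed.

Lemma sum_degree_O (o : blowup_O) :
  \sum_(w | adj (in_O o) w) degree w <= d * (p + t * p) + t * d * (d + t * d).
Proof.
apply: leq_trans (sum_adj_O _ _) _; apply: leq_add.
  by apply: leq_sum_const => // e; apply: degree_C.
apply: leq_sum_const => // z; apply: degree_O.
Qed.

Hypotheses (p_gt0 : 0 < p) (q_gt0 : 0 < q) (N_gt0 : 0 < N).

Let d_gt0 : 0 < d. Proof. by rewrite muln_gt0 q_gt0. Qed.
Let le_pd : p <= d. Proof. by rewrite leq_pmull. Qed.
Let le_dQ : d <= Q. Proof. by rewrite /Q -mulnA leq_pmulr // muln_gt0 q_gt0. Qed.

(** Up to factors [K] and [K ^ 2], the degree and the number of 2-walks are at most 1 and Q on A, Q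
    and Q on B, p and pQ on C, d and d^2 on O. Each summand is a class size times the powers [u] and
    [s] of these. *)
Lemma sum_blowup u s (K := t.+2) :
  \sum_(v : blowup) degree v ^ u * (\sum_(w | adj v w) degree w) ^ s <=
  K ^ (u + 2 * s) *
    (d ^ 2 * Q ^ s.+1 + d ^ 2 * Q ^ (u + s) +
     (q * d * p ^ (u + s) * Q ^ s + t * d ^ (u + 2 * s).+1)).
Proof.
have split_K x y :
    (K * x) ^ u * (K ^ 2 * y) ^ s = K ^ (u + 2 * s) * (x ^ u * y ^ s).
  by rewrite !expnMn mul2n -addnn !expnD mulnACA.
have bound (x y x' y' : nat) : x <= K * x' -> y <= K ^ 2 * y' ->
    x ^ u * y ^ s <= K ^ (u + 2 * s) * (x' ^ u * y' ^ s).
  by move=> xx' yy'; rewrite -split_K leq_mul ?leq_expn2r.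
rewrite big_sumType /= !big_sumType /= !mulnDr.
apply: leq_add; apply: leq_add.
- rewrite (_ : _ * (d ^ 2 * _) =
           (d ^ 2 * Q) * (K ^ (u + 2 * s) * (1 ^ u * Q ^ s))).
    apply: leq_sum_const => // v; apply: bound.
      by apply: leq_trans (degree_A _) _; rewrite muln1.
    by apply: leq_trans (sum_degree_A _) _; rewrite /K; nia.
  by rewrite exp1n (expnS Q); ring.
- rewrite (_ : _ * (d ^ 2 * _) = d ^ 2 * (K ^ (u + 2 * s) * (Q ^ u * Q ^ s))).
    apply: leq_sum_const => // v; apply: bound.
      by apply: leq_trans (degree_B _) _; rewrite /K; nia.
    by apply: leq_trans (sum_degree_B _) _; rewrite /K; nia.
  by rewrite (expnD Q); ring.
- rewrite (_ : _ * (q * _ * _ * _) =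
           (q * d) * (K ^ (u + 2 * s) * (p ^ u * (p * Q) ^ s))).
    apply: leq_sum_const => // v; apply: bound.
      by apply: leq_trans (degree_C _) _; rewrite /K; nia.
    by apply: leq_trans (sum_degree_C _) _; rewrite /K; nia.
  by rewrite (expnD p) expnMn; ring.
- rewrite (_ : _ * (t * _) =
           (t * d) * (K ^ (u + 2 * s) * (d ^ u * (d ^ 2) ^ s))).
    apply: leq_sum_const => // v; apply: bound.
      by apply: leq_trans (degree_O _) _; rewrite /K; nia.
    by apply: leq_trans (sum_degree_O _) _; rewrite /K; nia.
  by rewrite -expnM -expnD (expnS d); ring.
Qed.

End PendantBlowup.

(** * Many homomorphisms from [T] to its blow-up *)

Section PendantHom.

Variables (T : sgraph) (p q N : nat) (a b c : T).
Hypotheses (ab : adj a b) (bc : adj b c) (ac : a != c).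
Hypotheses (deg_a : degree a = 1) (deg_b : degree b = 2) (deg_c : degree c = 2).

(** Each vertex outside a, b, c has d = qp images in O. The images of c, b, a then offer d, p and
    dqN choices, in total d^3 N, since the remaining coordinate of c is dictated by its other
    neighbour. *)
Lemma hom_blowup : (q * p) ^ #|T| * N <= hom T (blowup T p q N).
Proof.
have ba : adj b a by rewrite adj_sym.
have cb : adj c b by rewrite adj_sym.
have neq_adj (x y : T) : adj x y -> (x == y) = false.
  by move=> xy; apply: contraTF xy => /eqP->; rewrite adj_irrefl.
have adj_a y : adj a y -> y = b.
  have /eqP/cards1P[z az] := deg_a.
  have adjE w : adj a w = (w == z) by move/setP: az => /(_ w); rewrite !inE.
  by move: ab; rewrite !adjE => /eqP-> /eqP.
have adj_b y : adj b y -> y = a \/ y = c.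
  have : [set a; c] \subset [set y | adj b y].
    by rewrite subUset !sub1set !inE ba bc.
  rewrite subEproper => /orP[/eqP/setP/(_ y)|].
    by rewrite !inE => <- /orP[]/eqP->; [left|right].
  by move/proper_card; rewrite cards2 ac -/(degree b) deg_b.
(* The images of [c] and of its other neighbour [e] must share their ['I_q] coordinate. *)
have [e [ce be adj_c]] : exists e, [/\ adj c e, b != e &
    forall y, adj c y -> y = b \/ y = e].
  have /eqP/cards2P[x [y [xy cE]]] := deg_c.
  have adjE w : adj c w = (w == x) || (w == y).
    by move/setP: cE => /(_ w); rewrite !inE.
  move: cb; rewrite adjE => /orP[]/eqP->; [exists y|exists x].
    split=> [||w]; rewrite ?adjE ?eqxx ?orbT //.
    by case/orP=> /eqP->; [left|right].
  split=> [||w]; rewrite ?adjE ?eqxx //; first by rewrite eq_sym.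
  by case/orP=> /eqP->; [right|left].
have ea : (e == a) = false.
  apply/eqP=> ea; have /adj_a c_b : adj a c by rewrite adj_sym -ea.
  by have := bc; rewrite c_b adj_irrefl.
pose base := blowup_base p q.
(* The values of g at a, b, c only fill the free coordinates of the images of
   a, b, c, with (g b).1 going to the image of a. *)
pose emb (g : {ffun T -> base} * 'I_N) : {ffun T -> blowup T p q N} :=
  let vc := ((g.1 e).1, g.1 c) in
  let vb := (vc, (g.1 b).2) in
  [ffun x => if x == a then in_A T (vb, (g.1 a, (g.1 b).1, g.2))
             else if x == b then in_B T N vb
             else if x == c then in_C T N vc
             else in_O N (x, g.1 x)].
have embA g : emb g a =
    in_A T ((((g.1 e).1, g.1 c), (g.1 b).2), (g.1 a, (g.1 b).1, g.2)).
  by rewrite ffunE eqxx.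
have embB g : emb g b = in_B T N ((((g.1 e).1, g.1 c), (g.1 b).2)).
  by rewrite ffunE eqxx neq_adj.
have embC g : emb g c = in_C T N ((g.1 e).1, g.1 c).
  by rewrite ffunE eqxx eq_sym (negPf ac) neq_adj.
have embO g x : x != a -> x != b -> x != c -> emb g x = in_O N (x, g.1 x).
  by move=> xa xb xc; rewrite ffunE (negPf xa) (negPf xb) (negPf xc).
have emb_inj : injective emb.
  (* The image of [a] alone reveals [n] and the values of [g] at [a], [b] and [c]. *)
  move=> [g n] [g' n'] eqE.
  have := congr1 (fun f : {ffun T -> _} => f a) eqE.
  rewrite !embA => -[_ gc gb2 ga gb1 nn']; congr (_, _) => //.
  apply/ffunP=> x; have [->|xa] := eqVneq x a; first exact: ga.
  have [->|xb] := eqVneq x b.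
    by move: gb1 gb2 => /=; case: (g b) (g' b) => [? ?] [? ?] /= -> ->.
  have [->|xc] := eqVneq x c; first exact: gc.
  by have := congr1 (fun f : {ffun T -> _} => f x) eqE; rewrite !embO // => -[].
have -> : (q * p) ^ #|T| * N = #|({ffun T -> base} * 'I_N : finType)%type|.
  by rewrite card_prod card_ffun card_prod !card_ord.
rewrite -(card_codom emb_inj) /hom.
apply/subset_leq_card/subsetP => _ /codomP[g ->].
rewrite inE; apply/forallP=> x; apply/forallP=> y; apply/implyP.
have [->|xa] := eqVneq x a; first by move/adj_a->; rewrite embA embB /= eqxx.
have [->|xb] := eqVneq x b.
  by case/adj_b=> ->; rewrite embB ?embA ?embC /= eqxx.
have [->|xc] := eqVneq x c.
  case/adj_c=> ->; rewrite embC ?embB /= ?eqxx // embO /= ?eqxx ?ea //.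
    by rewrite eq_sym.
  by rewrite eq_sym neq_adj.
have [->|ya] := eqVneq y a.
  by rewrite adj_sym => /adj_a x_b; rewrite x_b eqxx in xb.
have [->|yb] := eqVneq y b.
  rewrite adj_sym => /adj_b[] x_; first by rewrite x_ eqxx in xa.
  by rewrite x_ eqxx in xc.
have [->|yc] := eqVneq y c.
  rewrite adj_sym => /adj_c[] x_; first by rewrite x_ eqxx in xb.
  by rewrite embC embO //= x_.
by rewrite !embO.
Qed.

End PendantHom.

(** * Comparison of exponents and conclusion *)

Lemma blowup_weights u s t N (L := (u + s) * s.+1)
    (p := N ^ (L - s)) (q := N ^ s) (d := q * p) (Q := d * q * N) :
  1 < u -> 1 < s -> 0 < N ->
  d ^ 2 * Q ^ s.+1 + d ^ 2 * Q ^ (u + s) +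
    (q * d * p ^ (u + s) * Q ^ s + t * d ^ (u + 2 * s).+1) <=
  (t + 3) * d ^ (u + 2 * s).+1.
Proof.
move=> u_gt1 s_gt1 N_gt0.
(* Here [s <= L], so the subtraction in [p] does not truncate. *)
have dE : d = N ^ L by rewrite /d -expnD subnKC // /L; nia.
have QE : Q = N ^ (L + s).+1 by rewrite /Q dE -expnD -expnSr.
have -> : (t + 3) * d ^ (u + 2 * s).+1 =
    d ^ (u + 2 * s).+1 + d ^ (u + 2 * s).+1 +
    (d ^ (u + 2 * s).+1 + t * d ^ (u + 2 * s).+1) by ring.
(* The target exponent is L(u+2s+1). Class A needs (s+1)^2 <= L(u+s-2), true for u >= 2. Since
   (s+1)(u+s) = L, class B has L(u+s+3), which is small enough as s >= 2. Class C has the target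
   plus s(2-u), and class O has the target itself. *)
rewrite leq_add ?leq_add // QE dE /p /q -!expnM -!expnD leq_pexp2l // /L; nia.
Qed.

Lemma hom_le_card (H G : sgraph) : hom H G <= #|G| ^ #|H|.
Proof. by rewrite -card_ffun max_card. Qed.

Import Order.TTheory GRing.Theory Num.Theory.

(** Equal orders give both densities the same denominator, so comparing densities means comparing
    counts. *)
Lemma dominates_hom_le (H T G : sgraph) :
  #|H| = #|T| -> 0 < num_edges H -> num_edges H <= num_edges T -> 0 < #|G| ->
  dominates H T -> hom T G <= hom H G.
Proof.
move=> card_eq eH_gt0 le_edges G_gt0 /(_ G) dom.
rewrite leqNgt; apply/negP=> lt_hom.
move: dom; apply/negP; rewrite -Order.TotalTheory.ltNge.
have pow_gt0 n : (0 < #|G|%:R ^+ n :> rat)%R by rewrite exprn_gt0 ?ltr0n.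
have dens_ge0 K : (0 <= hom_density K G)%R by rewrite divr_ge0 ?ler0n ?ltW.
have dens_le1 : (hom_density H G <= 1)%R.
  by rewrite ler_pdivrMr // mul1r -natrX ler_nat hom_le_card.
(* Densities are at most 1, so replacing the exponent [num_edges T] by the smaller [num_edges H] can
   only increase the power. *)
apply: le_lt_trans (_ : _ <= hom_density H G ^+ num_edges H)%R _.
  by apply: ler_wiXn2l.
rewrite ltrXn2r ?gtn_eqF // /hom_density card_eq.
by rewrite ltr_pM2r ?invr_gt0 // ltr_nat.
Qed.

Theorem theorem6p11 (k l : nat) (H T : sgraph)
    (H_near_star : near_star H)
    (H_order : #|H| = k)
    (H_leaves : #|leaves H| = l)
    (l_lower : k + 1 <= 2 * l)
    (l_upper : l + 3 <= k)
    (T_tree : is_tree T)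
    (T_order : #|T| = k)
    (T_path : exists a b c : T,
        [/\ uniq [:: a; b; c], adj a b & adj b c] /\
        [/\ a \in leaves T, degree b = 2 & degree c = 2]) :
  ~ dominates H T.
Proof.
case: H_near_star => -[connH _] [m [F [F_edges isoH]]].
have card_H : k = (m + #|F|).+1.
  case: (isoH) => f /bij_eq_card; rewrite H_order => -> _.
  exact: card_subdivided_star.
have le_Fm := card_star_edges_le F_edges.
(* The bounds on [l] force k >= 7, while k <= 2m+1, so m > 1 and the leaf count applies. *)
have m_l : m = l.
  have := isomorphic_leaves isoH; have := isomorphic_leaves (isomorphic_inv isoH).
  by rewrite card_leaves_subdivided_star ?H_leaves //; lia.
case: T_tree => connT _.
case: T_path => a [b [c [[abc_uniq ab bc] [a_leaf deg_b deg_c]]]].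
have ac : a != c.
  by move: abc_uniq; rewrite /= !inE negb_or -andbA => /and4P[].
have deg_a : degree a = 1 by move: a_leaf; rewrite inE => /eqP.
pose s := #|F|; pose u := m - s.
(* With k = m+s+1 and l = m, [l_upper] reads s >= 2 and [l_lower] reads m-s >= 2. *)
have s_gt1 : 1 < s by lia.
have u_gt1 : 1 < u by lia.
have kE : k = (u + 2 * s).+1 by lia.
(* One more than the constant in the upper bound for [hom H G], so the extra factor [N] in
   [hom_blowup] wins strictly. *)
pose N := ((k.+2) ^ (u + 2 * s) * (k + 3)).+1.
pose L := (u + s) * s.+1.
pose p := N ^ (L - s); pose q := N ^ s.
have p_gt0 : 0 < p by rewrite expn_gt0.
have q_gt0 : 0 < q by rewrite expn_gt0.
pose G := blowup T p q N.
have lt_hom : hom H G < hom T G.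
  apply: leq_ltn_trans (isomorphic_hom G isoH) _.
  apply: leq_ltn_trans (hom_subdivided_star F_edges G) _.
  apply: leq_ltn_trans (sum_blowup T p_gt0 q_gt0 (ltn0Sn _) u s) _.
  apply: leq_trans (hom_blowup p q N ab bc ac deg_a deg_b deg_c).
  have /= := @blowup_weights u s #|T| N u_gt1 s_gt1 (ltn0Sn _).
  rewrite T_order -kE -/L -/p -/q => weights.
  apply: leq_ltn_trans (leq_mul (leqnn _) weights) _.
  have d_gt0 : 0 < (q * p) ^ k by rewrite expn_gt0 muln_gt0 q_gt0 p_gt0.
  by rewrite mulnA [ltnRHS]mulnC (ltn_pmul2r d_gt0).
have e_H : num_edges H <= k.-1.
  rewrite card_H; apply: leq_trans (isomorphic_num_edges isoH) _.
  exact: num_edges_subdivided_star.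
(* For [T] this yields [num_edges H <= num_edges T], and for [H] it yields an edge. *)
have := connected_num_edges connT; have := connected_num_edges connH.
rewrite H_order T_order => H_edges T_edges dom.
have G_gt0 : 0 < #|G|.
  have := leq_ltn_trans (leq0n _) (leq_trans lt_hom (hom_le_card T G)).
  by rewrite expn_gt0 T_order kE orbF.
move: lt_hom; rewrite ltnNge => /negP; apply.
by apply: dominates_hom_le dom; rewrite ?H_order ?T_order //; lia.
Qed.
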